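(* Let $\mathcal{A}$ be a finite action set and let $(A_1,A_2,\tilde Y,Y)$ be a random element of $\mathcal{A}\times\mathcal{A}\times\{+1,-1\}\times\{+1,-1\}$ such that $P(Y=+1\mid A_1=a_1,A_2=a_2)=p(a_1\succ a_2)$ and $P(Y=-1\mid A_1=a_1,A_2=a_2)=p(a_2\succ a_1)$ for a preference model $p(\cdot\succ\cdot)$, and $$P(\tilde Y=-1\mid Y=+1)=\epsilon_{\mathrm p},\qquad P(\tilde Y=+1\mid Y=-1)=\epsilon_{\mathrm n},\qquad \epsilon_{\mathrm p},\epsilon_{\mathrm n}\in[0,0.5).$$ Put $\pi_{\mathrm p}=P(Y=+1)$. For each $(a_1,a_2)\in\mathcal{A}\times\mathcal{A}$ generate a $\mathrm{Bernoulli}(1/2)$ random variable $b_{(a_1,a_2)}$, these variables being independent of each other and of $(A_1,A_2,\tilde Y,Y)$, and let $\mathcal{P}=\{(a_1,a_2)\in\mathcal{A}\times\mathcal{A}: b_{(a_1,a_2)}=1\}$. Let $(A_1',A_2',\tilde Y',Y')=h_{\mathcal{P}}(A_1,A_2,\tilde Y,Y)$. Then $$P(Y'=+1)=\tfrac12,$$ $$P(\tilde Y'=-1\mid Y'=+1)=P(\tilde Y'=+1\mid Y'=-1)=\pi_{\mathrm p}\epsilon_{\mathrm p}+(1-\pi_{\mathrm p})\epsilon_{\mathrm n}.$$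
   Context: For a subset $\mathcal{S}\subseteq\mathcal{A}\times\mathcal{A}$, the flip function $h_{\mathcal{S}}$ on $\mathcal{A}\times\mathcal{A}\times\{+1,-1\}\times\{+1,-1\}$ is defined by $h_{\mathcal{S}}(a_1,a_2,y,y')=(a_2,a_1,-y,-y')$ if $(a_1,a_2)\in\mathcal{S}$, and $h_{\mathcal{S}}(a_1,a_2,y,y')=(a_1,a_2,y,y')$ otherwise. The probabilities $P$ in the conclusion are taken over the randomness of both $(A_1,A_2,\tilde Y,Y)$ and the Bernoulli variables. *)

(* Defs.v *)
From HB Require Import structures.
From mathcomp Require Import all_boot all_order all_algebra.
From mathcomp Require Import all_classical all_reals all_analysis.

Set Implicit Arguments.
Unset Strict Implicit.
Unset Printing Implicit Defensive.
Import Order.TTheory GRing.Theory Num.Theory.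
Local Open Scope classical_set_scope.
Local Open Scope ring_scope.

(* The labels +1 ([pos]) and -1 ([neg]). *)
Inductive sign : Type := pos | neg.

Definition opp_sign (y : sign) : sign := if y is pos then neg else pos.

Definition flip (A : finType) (S : {set A * A}) (z : A * A * sign * sign) :
    A * A * sign * sign :=
  let: (a1, a2, y, y') := z in
  if (a1, a2) \in S then (a2, a1, opp_sign y, opp_sign y')
  else (a1, a2, y, y').

(* [p a b] is the probability that [a] is preferred to [b]. *)
Definition preference_model (R : realType) (A : finType) (p : A -> A -> R) :
    Prop :=
  (forall a b, 0 <= p a b <= 1) /\ (forall a b, p a b + p b a = 1).

Definition pr d (T : measurableType d) (R : realType) (P : probability T R)
  (E : set T) : R := fine (P E).

(* P(E | F); by the convention x / 0 = 0 this is 0 when P(F) = 0, so an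
   assumption on [cpr P E F] has to be restricted to P(F) > 0. *)
Definition cpr d (T : measurableType d) (R : realType) (P : probability T R)
  (E F : set T) : R := pr P (E `&` F) / pr P F.

(* Intended for a finite set [U], whose sigma-algebra consists of all its
   subsets. *)
Definition random_element d (T : measurableType d) (U : Type) (X : T -> U) :
  Prop := forall B : set U, measurable (X @^-1` B).

Definition events_of (T U : Type) (X : T -> U) : set (set T) :=
  [set X @^-1` B | B in [set: set U]].

Definition mutually_independent d (T : measurableType d) (R : realType)
    (P : probability T R) (I : finType) (G : I -> set (set T)) : Prop :=
  forall (J : {set I}) (E : I -> set T),
    (forall i, i \in J -> G i (E i)) ->
    pr P (\bigcap_(i in [set` J]) E i) = \prod_(i in J) pr P (E i).

(* Index [None] carries [X], index [Some i] carries [b i]: the [b i] are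
   independent of each other and, jointly, of [X]. *)
Definition independent_with d (T : measurableType d) (R : realType)
    (P : probability T R) (U V : Type) (X : T -> U)
    (I : finType) (b : I -> T -> V) : Prop :=
  mutually_independent P
    (fun o : option I => if o is Some i then events_of (b i) else events_of X).

(* Main.v *)
(** Conditionally on the data, the coin attached to the observed pair is still
    fair, since it is independent of the data. Hence the flipped tuple is an even
    mixture of the law of [(A1, A2, Yt, Y)] and of its image under the full flip.
    The full flip exchanges the two labels and the two kinds of label error, so
    both label probabilities and both error probabilities get averaged. *)

Require Import Defs.
From HB Require Import structures.
From mathcomp Require Import all_boot all_order all_algebra.
From mathcomp Require Import all_classical all_reals all_analysis.
From mathcomp Require Import lra.

Set Implicit Arguments.
Unset Strict Implicit.
Unset Printing Implicit Defensive.
Import Order.TTheory GRing.Theory Num.Theory.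
Local Open Scope classical_set_scope.
Local Open Scope ring_scope.

Section pr_theory.
Context d (T : measurableType d) (R : realType) (P : probability T R).

Lemma pr_ge0 (E : set T) : 0 <= pr P E.
Proof. exact: fine_ge0. Qed.

Lemma le_pr (E F : set T) : measurable E -> measurable F -> E `<=` F ->
  pr P E <= pr P F.
Proof.
move=> mE mF EF; apply: fine_le; rewrite ?fin_num_measure//.
by apply: le_measure; rewrite ?inE.
Qed.

Lemma pr_setU (E F : set T) : measurable E -> measurable F ->
  E `&` F = set0 -> pr P (E `|` F) = pr P E + pr P F.
Proof.
by move=> mE mF EF; rewrite /pr measureU// fineD// fin_num_measure.
Qed.

Lemma total_pr (I : finType) (k : T -> I) (E : set T) :
  (forall i, measurable (E `&` k @^-1` [set i])) ->
  pr P E = \sum_i pr P (E `&` k @^-1` [set i]).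
Proof.
move=> mE.
have -> : pr P E = pr P (\bigcup_(i in [set` enum I]) (E `&` k @^-1` [set i])).
  congr (pr P _); apply/seteqP; split=> [w Ew|w [i _ [//]]].
  by exists (k w) => //=; rewrite mem_enum.
rewrite /pr measure_fin_bigcup//; last first.
  by move=> i j _ _ [w [[_ /= <-] [_ /= <-]]].
rewrite -fsbig_seq ?enum_uniq// big_enum/=.
by rewrite sum_fine// => i _; rewrite fin_num_measure.
Qed.

(** No positivity of [pr P F] is needed: if [F] is null, so is its subset [E]&[F] by monotonicity,
    and both sides vanish. *)
Lemma cprK (E F : set T) : measurable E -> measurable F ->
  cpr P E F * pr P F = pr P (E `&` F).
Proof.
move=> mE mF; rewrite /cpr.
have [F0|F0] := eqVneq (pr P F) 0; last by rewrite divfK.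
rewrite F0 mulr0; apply/le_anti; rewrite pr_ge0/= -F0.
by apply: le_pr => //; exact: measurableI.
Qed.

(** Trades a conditional probability known only under [0 < pr P F] for a product formula without
    that guard, so null labels need no separate treatment later. *)
Lemma cpr_mul (E F : set T) (e : R) : measurable E -> measurable F ->
  (0 < pr P F -> cpr P E F = e) -> pr P (E `&` F) = pr P F * e.
Proof.
move=> mE mF EFe; rewrite -cprK// mulrC.
have := pr_ge0 F; rewrite le_eqVlt => /orP[/eqP<-|/EFe->//].
by rewrite !mul0r.
Qed.

Lemma pr_fair_coin (b : {RV P >-> bool}) (v : bool) :
  distribution P b =1 bernoulli_prob (2^-1 : R) ->
  pr P (b @^-1` [set v]) = 2^-1.
Proof.
move=> /(_ [set v]); rewrite /distribution/pushforward/pr => ->.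
(* The Bernoulli formula sits behind a test that the parameter lies in [0, 1]. *)
rewrite /bernoulli_prob ifT; last by apply/andP; split; lra.
by rewrite fsbig_set1/=; case: v => /=; lra.
Qed.

Section selected_coin.
Context (U : Type) (X : T -> U) (I : finType) (k : U -> I)
  (b : I -> {RV P >-> bool}).
Hypothesis mX : random_element X.
Hypothesis b_fair : forall i, distribution P (b i) =1 bernoulli_prob (2^-1 : R).
Hypothesis indep : independent_with P X (fun i => b i : T -> bool).

(** The coin read here has a random index, [k (X w)], so independence cannot be applied directly.
    Intersecting with a level set of the index leaves one fixed coin. *)
Let selected (B : set U) (v : bool) : set T :=
  [set w | B (X w) /\ b (k (X w)) w = v].

Let selectedI B v i : selected B v `&` (k \o X) @^-1` [set i] =
  X @^-1` (B `&` k @^-1` [set i]) `&` b i @^-1` [set v].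
Proof.
apply/seteqP; split=> [w [[BX bv] /= kX]|w [[BX /= kX] /= bv]].
  by rewrite -kX; split.
by split=> //; split=> //=; rewrite kX.
Qed.

Let mb i v : measurable (b i @^-1` [set v]).
Proof. exact: measurable_funPTI. Qed.

Let measurable_selectedI B v i :
  measurable (selected B v `&` (k \o X) @^-1` [set i]).
Proof. by rewrite selectedI; exact: measurableI. Qed.

Lemma measurable_selected_coin B v : measurable (selected B v).
Proof.
rewrite (_ : selected B v =
  \bigcup_(i in [set: I]) (selected B v `&` (k \o X) @^-1` [set i])).
  by apply: fin_bigcup_measurable => // i _; exact: measurable_selectedI.
apply/seteqP; split=> [w Bw|w [i _ [//]]].
by exists (k (X w)).
Qed.

Lemma pr_indep_coin B i v :
  pr P (X @^-1` B `&` b i @^-1` [set v]) = pr P (X @^-1` B) * 2^-1.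
Proof.
(* Mutual independence is applied to the two indices [None] and [Some i] only; the other values of
   [E] are irrelevant. *)
pose E (o : option I) := if o is Some j then b j @^-1` [set v] else X @^-1` B.
have := indep (J := finset.setU (finset.set1 None) (finset.set1 (Some i)))
  (E := E).
rewrite big_setU1 ?inE//= big_set1/= pr_fair_coin// => <-.
  congr (pr P _); apply/seteqP; split=> [w [Bw bw] o|w].
    by rewrite /= !inE => /orP[] /eqP->.
  by move=> Ew; split; [apply: (Ew None)|apply: (Ew (Some i))];
    rewrite /= !inE eqxx ?orbT.
by case=> [j|] _; [exists [set v]|exists B].
Qed.

(** On each slice where the index equals [i], the coin is [b i], fair and independent of [X].
    Summing over the finitely many slices restores the whole event. *)
Lemma pr_selected_coin B v : pr P (selected B v) = 2^-1 * pr P (X @^-1` B).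
Proof.
rewrite (total_pr (measurable_selectedI B v)).
rewrite (@total_pr _ (k \o X) (X @^-1` B)); last first.
  by move=> i; exact: (mX (B `&` k @^-1` [set i])).
rewrite mulr_sumr; apply: eq_bigr => i _.
by rewrite selectedI pr_indep_coin mulrC.
Qed.

End selected_coin.

(** Only the coin at the observed pair [z.1.1] matters. If it is [false] the tuple is kept; if
    [true], the random flip acts like [flip (finset predT)], which flips every pair. These two cases
    are disjoint, and each has a selected coin. *)
Lemma pr_random_flip (A : finType) (Z : T -> A * A * sign * sign)
    (b : A * A -> {RV P >-> bool}) (C : set (A * A * sign * sign)) :
  random_element Z ->
  (forall ab, distribution P (b ab) =1 bernoulli_prob (2^-1 : R)) ->
  independent_with P Z (fun ab => b ab : T -> bool) ->
  pr P [set w | C (flip (finset (fun ab => b ab w)) (Z w))] =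
  2^-1 * (pr P (Z @^-1` C) + pr P (Z @^-1` (flip (finset predT) @^-1` C))).
Proof.
move=> mZ b_fair indep.
pose k (z : A * A * sign * sign) := z.1.1.
rewrite mulrDr -(pr_selected_coin k mZ b_fair indep C false).
rewrite -(pr_selected_coin k mZ b_fair indep (flip (finset predT) @^-1` C) true).
rewrite -pr_setU; [|exact: measurable_selected_coin..|]; last first.
  by apply/seteqP; split=> // w [[_ /= ->] []].
congr (pr P _); apply/seteqP; split=> w /=; rewrite /k.
  case: (Z w) => [[[a1 a2] yt] y] /=; rewrite !inE.
  by case: ifPn => [bw|/negbTE bw] Cw; [right|left].
case: (Z w) => [[[a1 a2] yt] y] /=; rewrite !inE.
by case=> -[Cw ->].
Qed.

End pr_theory.

Theorem lemma3 (R : realType) (d : measure_display) (T : measurableType d)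
    (P : probability T R) (A : finType) (p : A -> A -> R)
    (A1 A2 : T -> A) (Yt Y : T -> sign)
    (b : A * A -> {RV P >-> bool}) (eps_p eps_n : R) :
  let Z := fun w => (A1 w, A2 w, Yt w, Y w) in
  preference_model p ->
  random_element Z ->
  (forall a1 a2, 0 < pr P [set w | A1 w = a1 /\ A2 w = a2] ->
     cpr P [set w | Y w = pos] [set w | A1 w = a1 /\ A2 w = a2] = p a1 a2) ->
  (forall a1 a2, 0 < pr P [set w | A1 w = a1 /\ A2 w = a2] ->
     cpr P [set w | Y w = neg] [set w | A1 w = a1 /\ A2 w = a2] = p a2 a1) ->
  0 <= eps_p < 2^-1 ->
  0 <= eps_n < 2^-1 ->
  (0 < pr P [set w | Y w = pos] ->
     cpr P [set w | Yt w = neg] [set w | Y w = pos] = eps_p) ->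
  (0 < pr P [set w | Y w = neg] ->
     cpr P [set w | Yt w = pos] [set w | Y w = neg] = eps_n) ->
  (forall ab, distribution P (b ab) =1 bernoulli_prob (2^-1 : R)) ->
  independent_with P Z (fun ab => b ab : T -> bool) ->
  let pi_p := pr P [set w | Y w = pos] in
  (* The random set of pairs whose Bernoulli variable equals 1. *)
  let PP := fun w => finset (fun ab => b ab w) in
  let Z' := fun w => flip (PP w) (Z w) in
  let Yt' := fun w => (Z' w).1.2 in
  let Y' := fun w => (Z' w).2 in
  [/\ pr P [set w | Y' w = pos] = 2^-1,
      cpr P [set w | Yt' w = neg] [set w | Y' w = pos]
        = pi_p * eps_p + (1 - pi_p) * eps_n
    & cpr P [set w | Yt' w = pos] [set w | Y' w = neg]
        = pi_p * eps_p + (1 - pi_p) * eps_n].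
Proof.
move=> Z _ mZ _ _ _ _ cpr_p cpr_n b_fair indep pi_p PP Z' Yt' Y'.
have mY y : measurable [set w | Y w = y] by exact: (mZ [set z | z.2 = y]).
have mYt y : measurable [set w | Yt w = y] by exact: (mZ [set z | z.1.2 = y]).
have pr_neg : pr P [set w | Y w = neg] = 1 - pi_p.
  apply/eqP; rewrite eq_sym subr_eq addrC -pr_setU//; last first.
    by apply/seteqP; split=> // w [/= ->].
  rewrite (_ : _ `|` _ = setT) ?/pr ?probability_setT//.
  by apply/seteqP; split=> // w _ /=; case: (Y w); [left|right].
have pr_err_p : pr P ([set w | Yt w = neg] `&` [set w | Y w = pos]) =
  pi_p * eps_p by exact: cpr_mul.
have pr_err_n : pr P ([set w | Yt w = pos] `&` [set w | Y w = neg]) =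
  (1 - pi_p) * eps_n by rewrite -pr_neg; exact: cpr_mul.
have opp_signE (f : T -> sign) y :
    [set w | opp_sign (f w) = y] = [set w | f w = opp_sign y].
  by apply/seteqP; split=> w /=; case: (f w); case: y.
(* The mixture averages the probabilities of [y] and of its opposite under [Y], which sum to 1. *)
have pr_Y' y : pr P [set w | Y' w = y] = 2^-1.
  rewrite (pr_random_flip [set z | z.2 = y] mZ b_fair indep).
  rewrite (_ : _ @^-1` (_ @^-1` _) = [set w | opp_sign (Y w) = y]); last first.
    by apply/seteqP; split=> w /=; rewrite inE.
  rewrite opp_signE (_ : _ @^-1` _ = [set w | Y w = y])//.
  by case: y => /=; rewrite pr_neg -/pi_p; lra.
(* Negating both labels turns a false negative into a false positive and conversely, so both values
   of [y] give the same two terms, in opposite orders. *)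
have pr_err y : pr P ([set w | Yt' w = opp_sign y] `&` [set w | Y' w = y]) =
    2^-1 * (pi_p * eps_p + (1 - pi_p) * eps_n).
  rewrite (pr_random_flip [set z | z.1.2 = opp_sign y /\ z.2 = y]
             mZ b_fair indep).
  rewrite (_ : _ @^-1` (_ @^-1` _) =
    [set w | opp_sign (Yt w) = opp_sign y] `&` [set w | opp_sign (Y w) = y]).
    rewrite !opp_signE -pr_err_p -pr_err_n; congr (_ * _).
    by case: y => //=; rewrite addrC.
  by apply/seteqP; split=> w /=; rewrite inE.
split; first exact: pr_Y'.
  (* The mixture weight 1/2 cancels against the probability 1/2 of the conditioning event. *)
  by rewrite /cpr pr_Y' (pr_err pos) mulrC mulKf// invr_neq0 ?pnatr_eq0.
by rewrite /cpr pr_Y' (pr_err neg) mulrC mulKf// invr_neq0 ?pnatr_eq0.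
Qed.
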